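(* Let $(p_i)_{i\in\mathbb{Z}}$ be a (generic) twisted Grassmann $n$-gon in $\mathrm{Gr}(N,3N)$ with associated matrices $X_i,Y_i$ ($i\in\mathbb{Z}$) and $Z$ in $\mathrm{GL}_N$. The pentagram map transforms the $X_i$, $Y_i$ and $Z$ by $$X_i\mapsto (X_i+Y_{i+1})^{-1}X_i(X_{i+2}+Y_{i+3}),\qquad Y_i\mapsto (X_i+Y_{i+1})^{-1}Y_{i+1}(X_{i+2}+Y_{i+3}),\qquad Z\mapsto Z.$$
   Context: $\mathrm{Gr}(N,3N)$ is the Grassmannian of $N$-dimensional subspaces of $\mathbb{R}^{3N}$; points are represented by rank-$N$ real $3N\times N$ matrices up to the right action of $\mathrm{GL}_N$ (column span). A twisted Grassmann $n$-gon is a bi-infinite sequence $(p_i)_{i\in\mathbb{Z}}$ of points of $\mathrm{Gr}(N,3N)$ with $p_{i+n}=Mp_i$ for all $i$, for some projective transformation $M\in \mathrm{PGL}_{3N}$ (the monodromy). A lift is a choice of matrices $V_i$ with column span $p_i$; it is twisted if $V_{i+n}=MV_i$ for a matrix $M\in\mathrm{GL}_{3N}$ representing the monodromy. Polygons are assumed nondegenerate: $(V_i\,V_{i+1}\,V_{i+2})$ is an invertible $3N\times3N$ matrix for every $i$, and the matrices in the relation $V_{i+3}=V_iA_i+V_{i+1}B_i+V_{i+2}C_i$ lie in $\mathrm{GL}_N$. Normalization: starting from a twisted lift, one can rescale $V_i$ to $V_iG_i$, $G_i\in\mathrm{GL}_N$, so that all $C_i$ become the identity (take $G_1=\mathrm{Id}$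 and $G_{i+1}=C_{i-2}^{-1}G_i$). For the resulting normalized lift (again denoted $V_i$) one writes $V_{i+3}=V_iY_i+V_{i+1}X_i+V_{i+2}$. With $Z:=C_{n-1}C_nC_1\cdots C_{n-2}$ (computed from the $n$-periodic $C_i$ of the twisted lift) the normalized lift satisfies $V_{i+n}=MV_iZ^{-1}$, so that $X_{i+n}=ZX_iZ^{-1}$ and $Y_{i+n}=ZY_iZ^{-1}$. The data $(X_i,Y_i,Z)$ are determined by the polygon up to simultaneous conjugation; for the image polygon $Z$ is the matrix in the analogous relation $W_{i+n}=MW_iZ^{-1}$ for its normalized lift $W_i$. The pentagram map sends $(p_i)$ to $(q_i)$, $q_i=\mathscr{L}_i\cap\mathscr{L}_{i+1}$, where $\mathscr{L}_i=p_i+p_{i+2}$ (a $2N$-dimensional subspace). It is only defined generically; in particular all $X_i+Y_{i+1}$ are assumed invertible. *)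

(* Defs.v *)
From HB Require Import structures.
From mathcomp Require Import all_boot all_order all_algebra.
From mathcomp Require Import reals.

Set Implicit Arguments.
Unset Strict Implicit.
Unset Printing Implicit Defensive.

Import GRing.Theory.
Local Open Scope ring_scope.

Section GrassmannPolygons.

Variables (F : fieldType) (N : nat).

Implicit Types (n : nat) (i : int) (M : 'M[F]_(3 * N)).
Implicit Types (p : int -> {vspace 'cV[F]_(3 * N)}).
Implicit Types (U V W : int -> 'M[F]_(3 * N, N)).
Implicit Types (A B C G X Y : int -> 'M[F]_N) (Z : 'M[F]_N).

Definition colspan (m k : nat) (V : 'M[F]_(m, k)) : {vspace 'cV[F]_m} :=
  <<[seq col j V | j : 'I_k]>>%VS.

Definition transform M (U : {vspace 'cV[F]_(3 * N)}) : {vspace 'cV[F]_(3 * N)} :=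
  (linfun (mulmx M) @: U)%VS.

(* M is a representative in GL_{3N} of the monodromy, which is an element of
   PGL_{3N}; it is carried along because rescaling M rescales the matrix Z. *)
Definition twisted_gon n M p : Prop :=
  [/\ M \in unitmx,
      forall i, \dim (p i) = N
    & forall i, p (i + n%:Z) = transform M (p i)].

Definition lift_of p V : Prop := forall i, colspan (V i) = p i.

Definition twisted_lift n M p V : Prop :=
  lift_of p V /\ forall i, V (i + n%:Z) = M *m V i.

Definition recurrence V A B C : Prop :=
  forall i, V (i + 3) = V i *m A i + V (i + 1) *m B i + V (i + 2) *m C i.

Fact triple_size : (N + N + N = 3 * N)%N.
Proof. by rewrite !mulSn mul0n addn0 addnA. Qed.

Definition frame V i : 'M[F]_(3 * N) :=
  castmx (erefl, triple_size) (row_mx (row_mx (V i) (V (i + 1))) (V (i + 2))).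

Definition nondegenerate_lift V : Prop :=
  (forall i, frame V i \in unitmx) /\
  exists A B C, recurrence V A B C /\
    forall i, [/\ A i \in unitmx, B i \in unitmx & C i \in unitmx].

(* Two lifts of a polygon of points of dimension N differ by invertible right
   factors, so this does not depend on the choice of the lift V. *)
Definition nondegenerate_gon p : Prop :=
  exists2 V, lift_of p V & nondegenerate_lift V.

Definition gauge C G : Prop :=
  G 1 = 1%:M /\ forall i, G (i + 1) = invmx (C (i - 2)) *m G i.

(* C_{-1} C_0 C_1 ... C_{n-2}, that is, C_{n-1} C_n C_1 ... C_{n-2} when C is
   n-periodic. *)
Definition twist n C : 'M[F]_N :=
  \big[mulmx/1%:M]_(k < n) C ((k : nat)%:Z - 1).

(* (X, Y, Z) is obtained from some twisted lift U of p by rescaling U i to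
   U i *m G i. *)
Definition gon_data n M p X Y Z : Prop :=
  exists U A B C G,
    [/\ twisted_lift n M p U,
        recurrence U A B C,
        gauge C G,
        recurrence (fun i => U i *m G i) Y X (fun=> 1%:M)
      & Z = twist n C].

(* The same data, read off from an arbitrary normalized lift W through
   W_{i+n} = M W_i Z^{-1}. *)
Definition normalized_data n M p X Y Z : Prop :=
  exists W,
    [/\ lift_of p W,
        recurrence W Y X (fun=> 1%:M),
        Z \in unitmx
      & forall i, W (i + n%:Z) = M *m W i *m invmx Z].

Definition short_diagonal p i : {vspace 'cV[F]_(3 * N)} := (p i + p (i + 2)%R)%VS.

Definition pentagram p i : {vspace 'cV[F]_(3 * N)} :=
  (short_diagonal p i :&: short_diagonal p (i + 1)%R)%VS.

Definition simultaneously_conjugate X Y Z X' Y' (Z' : 'M[F]_N) : Prop :=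
  exists2 g : 'M[F]_N, g \in unitmx &
    [/\ forall i, X' i = invmx g *m X i *m g,
        forall i, Y' i = invmx g *m Y i *m g
      & Z' = invmx g *m Z *m g].

End GrassmannPolygons.

(* Main.v *)
(* In a normalized lift V_{i+3} = V_i Y_i + V_{i+1} X_i + V_{i+2}, the matrix
   W_i = V_i Y_i + V_{i+2} = V_{i+3} - V_{i+1} X_i lies in both short diagonals,
   so it is a lift of the image polygon.  Since W_{i+1} - W_i = V_{i+1} S_i with
   S_i = X_i + Y_{i+1}, one can solve for V_{i+3} in terms of W_i and W_{i+1};
   then W_{i+3} - W_{i+2} = V_{i+3} S_{i+2} is the recurrence for W, already
   normalized.  W_{i+n} = M W_i Z^{-1} is inherited from V, and two normalized
   lifts of the same polygon differ by a constant right factor. *)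
Require Import Defs.
From HB Require Import structures.
From mathcomp Require Import all_boot all_order all_algebra.
From mathcomp Require Import reals.

Set Implicit Arguments.
Unset Strict Implicit.
Unset Printing Implicit Defensive.

Import GRing.Theory.
Local Open Scope ring_scope.

(** The equivalence in the step lets one hypothesis serve both directions along the integers. The
    base point is free because gauges are anchored at 1. *)
Lemma int_step_ind (P : int -> Prop) (j : int) :
  P j -> (forall i, P i <-> P (i + 1)) -> forall i, P i.
Proof.
move=> Pj PS i; rewrite -(subrK j i) addrC.
elim/int_rec: (i - j) => [|k IHk|k IHk]; first by rewrite addr0.
  by rewrite -addn1 PoszD addrA -PS.
by rewrite PS -addn1 PoszD opprD addrA subrK.
Qed.

(** * Column spans as images of linear maps *)

Section ColumnSpan.

Variable F : fieldType.

Lemma colspanE m k (V : 'M[F]_(m, k)) : colspan V = limg (linfun (mulmx V)).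
Proof.
apply/eqP; rewrite eqEsubv; apply/andP; split.
  apply/span_subvP=> _ /mapP[j _ ->]; rewrite colE.
  by apply/memv_imgP; exists (delta_mx j 0); rewrite ?memvf // lfunE.
apply/subvP=> _ /memv_imgP[a _ ->]; rewrite lfunE /=.
have -> : V *m a = \sum_j a j 0 *: col j V.
  apply/matrixP=> i j; rewrite !mxE summxE; apply: eq_bigr => r _.
  by rewrite !mxE mulrC !ord1.
apply: memv_suml => j _; apply/memvZ/memv_span/map_f.
by rewrite mem_enum.
Qed.

Lemma memv_colspan m k (V : 'M[F]_(m, k)) (v : 'cV[F]_m) :
  reflect (exists a, v = V *m a) (v \in colspan V).
Proof.
rewrite colspanE; apply: (iffP memv_imgP) => [[a _ ->]|[a ->]]; exists a.
- by rewrite lfunE.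
- exact: memvf.
- by rewrite lfunE.
Qed.

Lemma colspan_sub_factor m k l (U : 'M[F]_(m, k)) (V : 'M[F]_(m, l)) :
  (colspan U <= colspan V)%VS -> exists H, U = V *m H.
Proof.
move=> /subvP UV.
(* The boolean equality makes [xchoose] applicable, so the columns of [H] are chosen
   constructively. *)
have colU j : exists a : 'cV_l, col j U == V *m a.
  have /memv_colspan[a ->] : col j U \in colspan V; last by exists a.
  by apply/UV/memv_colspan; exists (delta_mx j 0); rewrite colE.
exists (\matrix_(i, j) xchoose (colU j) i 0).
apply/matrixP=> i j; have /eqP/matrixP/(_ i 0) := xchooseP (colU j).
by rewrite !mxE => ->; apply: eq_bigr => r _; rewrite !mxE.
Qed.

Lemma colspan_mulr m k (V : 'M[F]_(m, k)) (H : 'M[F]_k) :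
  H \in unitmx -> colspan (V *m H) = colspan V.
Proof.
move=> uH; apply/vspaceP=> v; apply/memv_colspan/memv_colspan=> -[a ->].
  by exists (H *m a); rewrite mulmxA.
by exists (invmx H *m a); rewrite !mulmxA mulmxK.
Qed.

Lemma dim_colspan m k (V : 'M[F]_(m, k)) :
  (forall a : 'cV_k, V *m a = 0 -> a = 0) -> \dim (colspan V) = k.
Proof.
move=> injV; have := limg_ker_dim (linfun (mulmx (p := 1) V)) fullv.
rewrite -colspanE capfv dimvf /dim /= muln1.
suff /eqP-> : (lker (linfun (mulmx (p := 1) V)) == 0)%VS by rewrite dimv0 add0n.
rewrite -subv0; apply/subvP=> a; rewrite memv_ker lfunE /= => /eqP/injV->.
exact: mem0v.
Qed.

Lemma transform_colspan N k (M : 'M[F]_(3 * N)) (V : 'M[F]_(3 * N, k)) :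
  transform M (colspan V) = colspan (M *m V).
Proof.
apply/vspaceP=> v; apply/memv_imgP/memv_colspan=> [[u /memv_colspan[a ->] ->]|[a ->]].
  by exists a; rewrite lfunE /= mulmxA.
by exists (V *m a); [apply/memv_colspan; exists a | rewrite lfunE /= mulmxA].
Qed.

End ColumnSpan.

Lemma mulmx_cast (R : pzSemiRingType) m n n' k (e : n = n')
    (A : 'M[R]_(m, n)) (B : 'M[R]_(n, k)) :
  castmx (erefl, e) A *m castmx (e, erefl) B = A *m B.
Proof. by case: n' / e; rewrite !castmx_id. Qed.

Lemma castmx0 (V : nmodType) m n m' n' (e : (m = m') * (n = n')) :
  castmx e (0 : 'M[V]_(m, n)) = 0.
Proof. exact: castmx_const. Qed.

(** * Frames, three-term recurrences and changes of lift *)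

Section Recurrences.

Variables (F : fieldType) (N : nat).
Implicit Types (V U W : int -> 'M[F]_(3 * N, N)).
Implicit Types (A B C G H X Y : int -> 'M[F]_N) (Z M : 'M[F]_N).

(** Invertibility of the frames in a form free of casts. The width [k] varies: 1 for vectors, [N]
    for coefficients of a recurrence, [3 * N] for a whole kernel matrix. *)
Definition free_triples V := forall i k (a b c : 'M[F]_(N, k)),
  V i *m a + V (i + 1) *m b + V (i + 2) *m c = 0 -> [/\ a = 0, b = 0 & c = 0].

Lemma frame_mulmx V i k (a b c : 'M[F]_(N, k)) :
  frame V i *m castmx (triple_size N, erefl) (col_mx (col_mx a b) c) =
  V i *m a + V (i + 1) *m b + V (i + 2) *m c.
Proof. by rewrite mulmx_cast !mul_row_col. Qed.

Lemma frames_unitP V : (forall i, frame V i \in unitmx) <-> free_triples V.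
Proof.
split=> [uV i k a b c | freeV i].
  rewrite -frame_mulmx => /(congr1 (mulmx (invmx (frame V i)))).
  rewrite mulKmx // mulmx0 => /(congr1 (castmx (esym (triple_size N), erefl))).
  by rewrite (castmxK (triple_size N) erefl) castmx0 -!col_mx0 => /eq_col_mx[/eq_col_mx[-> ->] ->].
rewrite -unitmx_tr -row_free_unit -kermx_eq0.
apply/eqP/trmx_inj; rewrite trmx0.
(* [kermx] is a left kernel, hence the transposes: the columns of [K] span the right kernel of the
   frame. Its three row blocks form a relation to which freeness applies. *)
set K := (kermx _)^T.
have : frame V i *m K = 0.
  by apply: trmx_inj; rewrite trmx_mul trmxK mulmx_ker trmx0.
rewrite -(castmxKV (triple_size N) erefl K).
set L := castmx _ K; rewrite -(vsubmxK L) -(vsubmxK (usubmx L)) frame_mulmx.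
by case/freeV=> -> -> ->; rewrite !col_mx0 castmx0.
Qed.

Lemma free_triples_coef V i k (a b c a' b' c' : 'M[F]_(N, k)) :
  free_triples V ->
  V i *m a + V (i + 1) *m b + V (i + 2) *m c =
  V i *m a' + V (i + 1) *m b' + V (i + 2) *m c' ->
  [/\ a = a', b = b' & c = c'].
Proof.
move=> freeV eqV; case: (freeV i k (a - a') (b - b') (c - c')).
  rewrite !mulmxBr [X in X + _]addrACA -opprD addrACA -opprD.
  by rewrite eqV subrr.
by move=> /subr0_eq-> /subr0_eq-> /subr0_eq->.
Qed.

Lemma free_triples_cancel V i k (a b : 'M[F]_(N, k)) :
  free_triples V -> V i *m a = V i *m b -> a = b.
Proof.
move=> freeV eqV; have [] // := @free_triples_coef V i k a 0 0 b 0 0 freeV.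
by rewrite eqV.
Qed.

Lemma free_triples_mulr V H :
  free_triples V -> (forall i, H i \in unitmx) ->
  free_triples (fun i => V i *m H i).
Proof.
move=> freeV uH i k a b c; rewrite -!mulmxA => /freeV[Ha Hb Hc].
split; [rewrite -(mulKmx (uH i) a) Ha | rewrite -(mulKmx (uH (i + 1)) b) Hb
  | rewrite -(mulKmx (uH (i + 2)) c) Hc]; exact: mulmx0.
Qed.

Lemma free_triples_mull (K : 'M[F]_(3 * N)) V :
  free_triples V -> K \in unitmx -> free_triples (fun i => K *m V i).
Proof.
move=> freeV uK i k a b c; rewrite -!mulmxA -!mulmxDr.
by move/(congr1 (mulmx (invmx K))); rewrite mulKmx // mulmx0 => /freeV.
Qed.

Lemma recurrence_mull (K : 'M[F]_(3 * N)) V A B C :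
  recurrence V A B C -> recurrence (fun i => K *m V i) A B C.
Proof. by move=> recV i; rewrite recV !mulmxDr !mulmxA. Qed.

Lemma recurrence_shift (j : int) V A B C : recurrence V A B C ->
  recurrence (fun i => V (i + j)) (fun i => A (i + j)) (fun i => B (i + j))
    (fun i => C (i + j)).
Proof. by move=> recV i; rewrite !(addrAC i _ j) recV. Qed.

(** Both sides are coefficients of [U (i + 3)] in the frame of [V] at [i]. Besides a change of lift,
    this covers periodicity: compare [M *m V i] with [V (i + n)]. *)
Lemma recurrence_gauge V U H A B C A' B' C' :
  free_triples V -> recurrence V A B C -> recurrence U A' B' C' ->
  (forall i, U i = V i *m H i) ->
  forall i, [/\ H i *m A' i = A i *m H (i + 3),
                H (i + 1) *m B' i = B i *m H (i + 3)
              & H (i + 2) *m C' i = C i *m H (i + 3)].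
Proof.
move=> freeV recV recU UV i; apply: (free_triples_coef (i := i) freeV).
by move: (recU i); rewrite !UV recV !mulmxDl !mulmxA => ->.
Qed.

Lemma recurrence_conj V A B C (g : 'M[F]_N) :
  g \in unitmx -> recurrence V A B C ->
  recurrence (fun i => V i *m g) (fun i => invmx g *m A i *m g)
    (fun i => invmx g *m B i *m g) (fun i => invmx g *m C i *m g).
Proof. by move=> ug recV i; rewrite recV !mulmxDl !mulmxA !mulmxK. Qed.

Lemma lift_gauge (p : int -> {vspace 'cV[F]_(3 * N)}) V U :
  free_triples V -> lift_of p V -> lift_of p U ->
  exists H, (forall i, H i \in unitmx) /\ (forall i, U i = V i *m H i).
Proof.
move=> freeV liftV liftU.
have eqUV i : exists K : 'M_N, U i == V i *m K.
  have [|K ->] := @colspan_sub_factor _ _ _ _ (U i) (V i); last by exists K.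
  by rewrite liftV liftU.
pose H i := xchoose (eqUV i); have UV i : U i = V i *m H i.
  exact/eqP/(xchooseP (eqUV i)).
exists H; split=> // i.
have [|K VU] := @colspan_sub_factor _ _ _ _ (V i) (U i).
  by rewrite liftV liftU.
suff /mulmx1_unit[] : H i *m K = 1%:M by [].
by apply: (free_triples_cancel (i := i) freeV); rewrite mulmxA -UV -VU mulmx1.
Qed.

(** * The normalizing gauge and its behaviour under a shift by the period *)

Lemma gauge_unit C G :
  (forall i, C i \in unitmx) -> gauge C G -> forall i, G i \in unitmx.
Proof.
move=> uC [G1 GS]; apply: (int_step_ind (j := 1)) => [|i].
  by rewrite G1 unitmx1.
by rewrite GS unitmx_mul unitmx_inv uC.
Qed.

(** Unrolled from [G 1 = 1], the gauge gives [G (1 + n)] as the product of the inverses of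
    [C (n - 2)], ..., [C (-1)], which telescopes against [twist]. *)
Lemma gauge_twist n C G :
  (forall i, C i \in unitmx) -> gauge C G -> twist n C *m G (1 + n%:Z) = 1%:M.
Proof.
move=> uC [G1 GS]; elim: n => [|n IHn].
  by rewrite /twist big_ord0 addr0 G1 mulmx1.
have -> : twist n.+1 C = twist n C *m C (n%:Z - 1).
  exact: (@big_ord_recr 'M[F]_N 1 *%R n).
have -> : 1 + n.+1%:Z = 1 + n%:Z + 1 by rewrite -addn1 PoszD addrA.
rewrite GS (_ : 1 + n%:Z - 2 = n%:Z - 1) ?mulmxA ?mulmxK //.
Qed.

Lemma gauge_period n C G :
  (forall i, C i \in unitmx) -> (forall i : int, C (i + n%:Z) = C i) -> gauge C G ->
  forall i, G (i + n%:Z) = G i *m invmx (twist n C).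
Proof.
move=> uC perC gG; have uG := gauge_unit uC gG.
have TG := gauge_twist n uC gG; case: gG => G1 GS.
have [uT _] := mulmx1_unit TG.
(* At 1 this is the telescoping identity; elsewhere both sides obey the same first-order recursion,
   [C] being periodic. *)
apply: (int_step_ind (j := 1)) => [|i].
  by rewrite -[LHS](mulKmx uT) TG mulmx1 G1 mul1mx.
rewrite addrAC !GS (addrAC i n%:Z) perC -mulmxA.
split=> [->// | /(congr1 (mulmx (C (i - 2))))].
by rewrite !mulmxA !mulmxV // !mul1mx.
Qed.

End Recurrences.

(** * Normalized lifts and their uniqueness *)

Section Pentagram.

Variables (F : fieldType) (N n : nat) (M : 'M[F]_(3 * N)).
Variable p : int -> {vspace 'cV[F]_(3 * N)}.
Implicit Types (V U W : int -> 'M[F]_(3 * N, N)) (X Y : int -> 'M[F]_N).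

Lemma normalized_lift X Y (Z : 'M[F]_N) :
  M \in unitmx -> nondegenerate_gon p -> gon_data n M p X Y Z ->
  exists V, [/\ lift_of p V, free_triples V, recurrence V Y X (fun=> 1%:M),
                forall i, X i \in unitmx /\ Y i \in unitmx
              & Z \in unitmx /\ forall i, V (i + n%:Z) = M *m V i *m invmx Z].
Proof.
move=> uM [V liftV [/frames_unitP freeV [A0 [B0 [C0 [recV uABC]]]]]].
case=> U [A [B [C [G [[liftU twU] recU gG recUG ->]]]]].
have [H [uH UV]] := lift_gauge freeV liftV liftU.
have freeU : free_triples U.
  by move=> i k a b c; rewrite !UV; apply: free_triples_mulr.
have gHU := recurrence_gauge freeV recV recU UV.
(* Nondegeneracy is known for some lift [V] only; the gauge relations carry invertibility first to
   [U], and below to the normalized lift. *)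
have uA i : A i \in unitmx.
  have [/(congr1 (fun K => K \in unitmx)) + _ _] := gHU i.
  by have [uA0 _ _] := uABC i; rewrite !unitmx_mul !uH uA0.
have uB i : B i \in unitmx.
  have [_ /(congr1 (fun K => K \in unitmx)) + _] := gHU i.
  by have [_ uB0 _] := uABC i; rewrite !unitmx_mul !uH uB0.
have uC i : C i \in unitmx.
  have [_ _ /(congr1 (fun K => K \in unitmx)) +] := gHU i.
  by have [_ _ uC0] := uABC i; rewrite !unitmx_mul !uH uC0.
(* [M *m U i] and [U (i + n)] are the same lift, so their coefficients agree. *)
have perC i : C (i + n%:Z) = C i.
  have MU j : U (j + n%:Z) = M *m U j *m 1%:M by rewrite mulmx1 twU.
  have [_ _] := recurrence_gauge (free_triples_mull freeU uM)
    (recurrence_mull M recU) (recurrence_shift n%:Z recU) MU i.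
  by rewrite mul1mx mulmx1.
have uG := gauge_unit uC gG.
have gUG := recurrence_gauge freeU recU recUG (fun i => erefl).
exists (fun i => U i *m G i); split=> //.
- by move=> i; rewrite colspan_mulr.
- exact: free_triples_mulr.
- move=> i; have [eA eB _] := gUG i; split.
    by move/(congr1 (fun K => K \in unitmx)): eB; rewrite !unitmx_mul !uG uB.
  by move/(congr1 (fun K => K \in unitmx)): eA; rewrite !unitmx_mul !uG uA.
split; first by have [] := mulmx1_unit (gauge_twist n uC gG).
by move=> i; rewrite twU (gauge_period uC perC gG) !mulmxA.
Qed.

Lemma normalized_period V X Y (Z : 'M[F]_N) :
  M \in unitmx -> free_triples V -> recurrence V Y X (fun=> 1%:M) ->
  Z \in unitmx -> (forall i, V (i + n%:Z) = M *m V i *m invmx Z) ->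
  forall i, Y (i + n%:Z) = Z *m Y i *m invmx Z.
Proof.
move=> uM freeV recV uZ VM i.
have [/(congr1 (mulmx Z)) + _ _] := recurrence_gauge (free_triples_mull freeV uM)
  (recurrence_mull M recV) (recurrence_shift n%:Z recV) VM i.
by rewrite mulKVmx // mulmxA.
Qed.

Lemma normalized_data_conj V X Y (Z : 'M[F]_N) X' Y' (Z' : 'M[F]_N) :
  M \in unitmx -> lift_of p V -> free_triples V ->
  recurrence V Y X (fun=> 1%:M) -> Z \in unitmx ->
  (forall i, V (i + n%:Z) = M *m V i *m invmx Z) ->
  normalized_data n M p X' Y' Z' <-> simultaneously_conjugate X Y Z X' Y' Z'.
Proof.
move=> uM liftV freeV recV uZ VM; split=> [[W [liftW recW uZ' WM]]|].
  have [H [uH WV]] := lift_gauge freeV liftV liftW.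
  have gH := recurrence_gauge freeV recV recW WV.
  (* Both third coefficients are 1, so the third gauge relation reads [H (i + 2) = H (i + 3)]. *)
  have Hconst i : H i = H 0.
    move: i; apply: (int_step_ind (j := 0)) => // i.
    have [_ _] := gH (i - 2); rewrite mulmx1 mul1mx.
    by rewrite subrK -addrA => ->.
  exists (H 0) => //; split=> [i|i|].
  - by have [_ + _] := gH i; rewrite !Hconst -mulmxA => <-; rewrite mulKmx.
  - by have [+ _ _] := gH i; rewrite !Hconst -mulmxA => <-; rewrite mulKmx.
  (* Both sides, multiplied on the left by [M *m V 0], equal [W n]. *)
  have : invmx Z *m H 0 = H 0 *m invmx Z'.
    apply: (free_triples_cancel (i := 0) (free_triples_mull freeV uM)).
    by rewrite !mulmxA -VM; have := WM 0; rewrite !WV !Hconst !mulmxA.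
  move/(congr1 (fun K => invmx (H 0) *m (Z *m (K *m Z')))).
  by rewrite /= -(mulmxA (invmx Z)) mulKVmx // mulKmx // mulmxKV // mulmxA.
case=> g ug [eX eY ->]; exists (fun i => V i *m g); split.
- by move=> i; rewrite colspan_mulr.
- move=> i; rewrite eX eY (recurrence_conj ug recV).
  by rewrite (mulmx1 (invmx g)) mulVmx.
- by rewrite !unitmx_mul unitmx_inv ug uZ.
move=> i; have uZ' : invmx g *m Z *m g \in unitmx.
  by rewrite !unitmx_mul unitmx_inv ug uZ.
rewrite -[LHS](mulmxK uZ'); congr (_ *m _).
by rewrite VM !mulmxA mulmxK // mulmxKV.
Qed.

(** * The lift of the image polygon *)

Variables (V : int -> 'M[F]_(3 * N, N)) (X Y : int -> 'M[F]_N).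
Hypothesis liftV : lift_of p V.
Hypothesis freeV : free_triples V.
Hypothesis recV : recurrence V Y X (fun=> 1%:M).

Definition pentagram_lift i := V i *m Y i + V (i + 2).
Notation W := pentagram_lift.

Lemma pentagram_lift_diff i : W i = V (i + 3) - V (i + 1) *m X i.
Proof. by rewrite recV mulmx1 addrAC addrK. Qed.

Lemma pentagram_lift_step i :
  W (i + 1) = W i + V (i + 1) *m (X i + Y (i + 1)).
Proof.
by rewrite (pentagram_lift_diff i) mulmxDr addrA subrK /W -(addrA i) [LHS]addrC.
Qed.

Lemma lift_of_pentagram : lift_of (pentagram p) W.
Proof.
move=> i; apply/vspaceP=> v; rewrite memv_cap; apply/idP/idP.
  move=> /memv_colspan[a ->]; apply/andP; split; rewrite /short_diagonal -!liftV.
    rewrite mulmxDl; apply: memv_add; apply/memv_colspan; last by exists a.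
    by exists (Y i *m a); rewrite mulmxA.
  rewrite pentagram_lift_diff -(addrA i) [_ - _]addrC mulmxDl mulNmx -mulmxN.
  apply: memv_add; apply/memv_colspan; last by exists a.
  by exists (- (X i *m a)); rewrite !mulmxN mulmxA.
case/andP; rewrite /short_diagonal -!liftV.
case/memv_addP=> _ /memv_colspan[a ->] [_ /memv_colspan[b ->] ->].
case/memv_addP=> _ /memv_colspan[c ->] [_ /memv_colspan[d ->]].
rewrite -(addrA i) recV mulmx1 => e.
(* A vector of the intersection is expanded in the frame at [i] in two ways. The outer coefficients
   give [a = Y i *m d] and [b = d], so the vector is [W i *m d]. *)
have eqd : V i *m a + V (i + 1) *m 0 + V (i + 2) *m b =
    V i *m (Y i *m d) + V (i + 1) *m (c + X i *m d) + V (i + 2) *m d.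
  rewrite mulmx0 addr0 e !mulmxDl mulmxDr !mulmxA !addrA; congr (_ + _ + _).
  by rewrite [LHS]addrC.
have [-> _ ->] := free_triples_coef freeV eqd.
by apply/memv_colspan; exists d; rewrite mulmxDl mulmxA.
Qed.

Hypothesis unitS : forall i, X i + Y (i + 1) \in unitmx.

Lemma pentagram_lift_inv i :
  V (i + 3) = W i *m (invmx (X i + Y (i + 1)) *m Y (i + 1)) +
              W (i + 1) *m (invmx (X i + Y (i + 1)) *m X i).
Proof.
(* With [W i] eliminated, the coefficients of [W (i + 1)] add up to 1, and what remains is
   [W (i + 1) - V (i + 1) *m Y (i + 1)]. *)
have -> : W i = W (i + 1) - V (i + 1) *m (X i + Y (i + 1)).
  by rewrite pentagram_lift_step addrK.
rewrite mulmxBl -mulmxA mulKVmx // addrAC -!mulmxDr.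
rewrite (addrC (Y _)) mulVmx // mulmx1 /W -(addrA i).
by rewrite addrAC subrr add0r.
Qed.

Lemma recurrence_pentagram :
  recurrence W
    (fun i => invmx (X i + Y (i + 1)) *m Y (i + 1) *m (X (i + 2) + Y (i + 3)))
    (fun i => invmx (X i + Y (i + 1)) *m X i *m (X (i + 2) + Y (i + 3)))
    (fun=> 1%:M).
Proof.
move=> i; have e3 : i + 3 = i + 2 + 1 by rewrite -addrA.
rewrite {1}e3 pentagram_lift_step -!e3 pentagram_lift_inv mulmx1 addrC.
by rewrite mulmxDl !mulmxA.
Qed.

(** The frame of [V] at [i + 1] fits: [W i] and [W (i + 1)] involve only [V (i + 1)] and
    [V (i + 3)], while [W (i + 2) - W (i + 1)] is a multiple of [V (i + 2)]. Invertibility of the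
    sums [X i + Y (i + 1)] then kills [c] and [a]. *)
Lemma free_triples_pentagram : free_triples W.
Proof.
move=> i k a b c.
have -> : i + 2 = i + 1 + 1 by rewrite -addrA.
rewrite (pentagram_lift_step (i + 1)) mulmxDl -(addrA (W i *m a)).
rewrite (addrA (W (i + 1) *m b)) -mulmxDr.
(* An opaque name for [b + c] keeps distributivity from splitting it. *)
have [d dE] : {d | d = b + c} by exists (b + c).
rewrite -dE => Wabc.
have [|Yd Sc ad] := @freeV (i + 1) k (Y (i + 1) *m d - X i *m a)
    ((X (i + 1) + Y (i + 1 + 1)) *m c) (a + d).
  rewrite -{}[RHS]Wabc (pentagram_lift_diff i) /W -(addrA i 1 2).
  rewrite mulmxBl mulmxDl mulmxBr (mulmxDr (V _) a d) !mulmxA [RHS]addrA [RHS]addrAC.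
  rewrite -!(addrA _ (- _)) [LHS]addrACA [RHS]addrACA; congr (_ + _).
  by rewrite [LHS]addrC.
have c0 : c = 0 by rewrite -(mulKmx (unitS (i + 1)) c) Sc mulmx0.
have da : d = - a by apply/eqP; rewrite -addr_eq0 addrC ad.
have a0 : a = 0.
  rewrite -(mulKmx (unitS i) a) mulmxDl; move/eqP: Yd.
  by rewrite da mulmxN -opprD oppr_eq0 addrC => /eqP->; rewrite mulmx0.
by move: da; rewrite dE a0 c0 addr0 oppr0.
Qed.

(** In the term [V i *m Y i], the factor [invmx Z] from [V] cancels the [Z] from the conjugated
    [Y]. *)
Lemma pentagram_lift_twisted (Z : 'M[F]_N) :
  M \in unitmx -> Z \in unitmx ->
  (forall i, V (i + n%:Z) = M *m V i *m invmx Z) ->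
  forall i, W (i + n%:Z) = M *m W i *m invmx Z.
Proof.
move=> uM uZ VM i; rewrite /W (addrAC i n%:Z) !VM.
rewrite (normalized_period uM freeV recV uZ VM) mulmxDr mulmxDl !mulmxA.
by rewrite mulmxKV.
Qed.

End Pentagram.

Theorem proposition7 (R : realType) (N n : nat) (N_gt0 : (0 < N)%N)
    (n_gt0 : (0 < n)%N) (M : 'M[R]_(3 * N))
    (p : int -> {vspace 'cV[R]_(3 * N)})
    (X Y : int -> 'M[R]_N) (Z : 'M[R]_N)
    (p_twisted : twisted_gon n M p)
    (p_nondeg : nondegenerate_gon p)
    (p_data : gon_data n M p X Y Z)
    (p_generic : forall i : int, X i + Y (i + 1) \in unitmx) :
  [/\ twisted_gon n M (pentagram p),
      nondegenerate_gon (pentagram p)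
    & forall (X' Y' : int -> 'M[R]_N) (Z' : 'M[R]_N),
        normalized_data n M (pentagram p) X' Y' Z' <->
        simultaneously_conjugate
          (fun i : int =>
             invmx (X i + Y (i + 1)) *m X i *m (X (i + 2) + Y (i + 3)))
          (fun i : int =>
             invmx (X i + Y (i + 1)) *m Y (i + 1) *m (X (i + 2) + Y (i + 3)))
          Z X' Y' Z'].
Proof.
have [uM _ _] := p_twisted.
have [V [liftV freeV recV uXY [uZ VM]]] := normalized_lift uM p_nondeg p_data.
have liftW := lift_of_pentagram liftV freeV recV.
have freeW := free_triples_pentagram freeV recV p_generic.
have recW := recurrence_pentagram recV p_generic.
have WM := pentagram_lift_twisted freeV recV uM uZ VM.
split=> [| |X' Y' Z'].
- split=> // i; rewrite -!liftW.
    apply: dim_colspan => a Wa.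
    by apply: (free_triples_cancel (i := i) freeW); rewrite mulmx0.
  by rewrite transform_colspan WM colspan_mulr // unitmx_inv.
- exists (pentagram_lift V Y) => //; split; first exact/frames_unitP.
  do 3!eexists; split; first exact: recW.
  move=> i; have [uX _] := uXY i; have [_ uY] := uXY (i + 1).
  have uS : X (i + 2) + Y (i + 3) \in unitmx.
    by have := p_generic (i + 2); rewrite -(addrA i).
  by rewrite !unitmx_mul !unitmx_inv p_generic uX uY uS unitmx1.
(* The uniqueness result is applied to the image polygon, with its lift in the role of [V] and the
   same [Z]. *)
exact: normalized_data_conj uM liftW freeW recW uZ WM.
Qed.
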